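(* Let $\Sigma$ be a compact, connected, oriented surface of genus $g$ with exactly one boundary component, let $n\ge1$ and suppose $k\ge3$. Let $\psi:\mathbf{B}_{n;k}(\Sigma)\to H$ be an arbitrary epimorphism onto a group $H$ that contains the free abelian group $G_D=\langle q\rangle\oplus\langle t\rangle$ of rank 2 as a subgroup, such that $\psi|_{\mathbf{B}_{n;k}(D)}=\psi_D$, that is, $\psi(\sigma_i)=t$ for $1\le i\le k-1$, $\psi(\zeta_j)=q$ for $1\le j\le n$ and $\psi(\bar\sigma_m)=1$ for $1\le m\le n-1$. Then $H$ is isomorphic to the group $H_\Sigma$ with generators $q,t,\bar m_1,\dots,\bar m_g,\bar\ell_1,\dots,\bar\ell_g,m_1,\dots,m_g,\ell_1,\dots,\ell_g$, in which all generators commute except for $$[m_r,\ell_r]=t^2,\qquad[\bar m_r,\ell_r]=[m_r,\bar\ell_r]=q\qquad(1\le r\le g).$$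
   Context: Conventions: $[x,y]=xyx^{-1}y^{-1}$; $D$ is the 2-disc, embedded in $\Sigma$. The inclusion induces a monomorphism $\mathbf{B}_{n;k}(D)\hookrightarrow\mathbf{B}_{n;k}(\Sigma)$, regarded as an inclusion; $\mathbf{B}_{n;k}(D)$ is generated by $\bar\sigma_1,\dots,\bar\sigma_{n-1},\sigma_1,\dots,\sigma_{k-1},\zeta_1,\dots,\zeta_n$, and $\psi_D:\mathbf{B}_{n;k}(D)\to H_D=G_D$ is the epimorphism $\sigma_i\mapsto t,\zeta_j\mapsto q,\bar\sigma_m\mapsto1$. $\mathbf{B}_{n;k}(\Sigma)$ is the fundamental group of the space of pairs of disjoint subsets of $\Sigma$ with $n$ and $k$ elements; it is the semidirect product of the normal subgroup $\mathbf{B}_{n,k}(\Sigma)$ ($\pi_1$ of the space of $k$-element subsets of $\Sigma$ minus $n$ points) and $\mathbf{B}_{0,n}(\Sigma)$ ($\pi_1$ of the space of $n$-element subsets of $\Sigma$). It has generators $X_1=\{\bar\sigma_1,\dots,\bar\sigma_{n-1},\bar\mu_1,\dots,\bar\mu_g,\bar\lambda_1,\dots,\bar\lambda_g\}$ (generators of $\mathbf{B}_{0,n}(\Sigma)$) and $X_2=\{\sigma_1,\dots,\sigma_{k-1},\zeta_1,\dots,\zeta_n,\mu_1,\dots,\mu_g,\lambda_1,\dots,\lambda_g\}$ (generators of $\mathbf{B}_{n,k}(\Sigma)$), with relations: (a) among $X_2$: $[\sigma_i,\sigma_j]=1$ for $|i-j|\ge2$; $\sigma_i\sigma_j\sigma_i=\sigma_j\sigma_i\sigma_j$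 for $|i-j|=1$; $\mu_r,\lambda_r,\zeta_t$ commute with $\sigma_i$ for $i>1$; $[x,\sigma_1x\sigma_1]=1$ for $x\in\{\mu_r,\lambda_r,\zeta_t\}$; $[x,\sigma_1^{-1}y\sigma_1]=1$ for $x\in\{\mu_r,\lambda_r\},y\in\{\mu_s,\lambda_s\}$ with $r<s$, for $x\in\{\mu_r,\lambda_r\},y=\zeta_u$, and for $x=\zeta_t,y=\zeta_u$ with $t<u$; $\sigma_1\lambda_r\sigma_1\mu_r\sigma_1=\mu_r\sigma_1\lambda_r$; (b) among $X_1$: the same relations for the barred generators (with $n$ in place of $k$ and no $\zeta$'s); (c) $\bar x^{-1}y\bar x=\bar x_*(y)$ for $\bar x\in X_1,y\in X_2$, where $(\bar\sigma_i)_*$: $\zeta_i\mapsto\zeta_i\zeta_{i+1}\zeta_i^{-1}$, $\zeta_{i+1}\mapsto\zeta_i$; $(\bar\mu_r)_*$: $\zeta_1\mapsto\mu_r\zeta_1\mu_r^{-1}$, $\mu_r\mapsto\mu_r\zeta_1\mu_r\zeta_1^{-1}\mu_r^{-1}$, $\lambda_r\mapsto\lambda_r\mu_r\zeta_1^{-1}\mu_r^{-1}$, $x\mapsto[\mu_r,\zeta_1]x[\mu_r,\zeta_1]^{-1}$ for $x\in\{\mu_s,\lambda_s\}$, $r<s$; $(\bar\lambda_r)_*$: $\zeta_1\mapsto\lambda_r\zeta_1\lambda_r^{-1}$, $\mu_r\mapsto\lambda_r\zeta_1\lambda_r^{-1}\mu_r\zeta_1\lambda_r\zeta_1^{-1}\lambda_r^{-1}$,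 $\lambda_r\mapsto\lambda_r\zeta_1\lambda_r\zeta_1^{-1}\lambda_r^{-1}$, $x\mapsto[\lambda_r,\zeta_1]x[\lambda_r,\zeta_1]^{-1}$ for $x\in\{\mu_s,\lambda_s\}$, $r<s$; all other generators in $X_2$ are fixed.
   Formalization: The case n = 1 with g ≥ 1 is excluded: there no σ̄ exists, the images of the μ̄_r, λ̄_r need not commute, and the claim fails; B_{n;k}(Σ) is taken to be the group given by its stated presentation. *)

(* Defs.v *)
From HB Require Import structures.
From mathcomp Require Import all_boot all_algebra.
From mathcomp Require Import boolp.

Set Implicit Arguments.
Unset Strict Implicit.
Unset Printing Implicit Defensive.

(** * Groups given by generators and relations *)

(* Formal group expressions; they become group elements only in the quotient
   [pres_group] below. *)
Inductive gterm (X : Type) : Type :=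
  | Gen of X
  | One
  | Mul of gterm X & gterm X
  | Inv of gterm X.
Arguments One {X}.

Declare Scope gterm_scope.
Delimit Scope gterm_scope with gt.
Bind Scope gterm_scope with gterm.
Notation "1" := One : gterm_scope.
Notation "x * y" := (Mul x y) : gterm_scope.
Notation "x ^-1" := (Inv x) : gterm_scope.

(* The convention is [x,y] = x y x^-1 y^-1, which is not that of the library's
   [~ x, y]. *)
Definition Comm X (x y : gterm X) : gterm X := (x * y * x^-1 * y^-1)%gt.

HB.instance Definition _ (X : Type) := gen_eqMixin (gterm X).
HB.instance Definition _ (X : Type) := gen_choiceMixin (gterm X).

(* [R u v] stands for the defining relation u = v. *)
Inductive pres_eq (X : Type) (R : gterm X -> gterm X -> Prop) :
    gterm X -> gterm X -> Prop :=
  | PresRel u v : R u v -> pres_eq R u v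
  | PresRefl u : pres_eq R u u
  | PresSym u v : pres_eq R u v -> pres_eq R v u
  | PresTrans u v w : pres_eq R u v -> pres_eq R v w -> pres_eq R u w
  | PresMul u u' v v' :
      pres_eq R u u' -> pres_eq R v v' -> pres_eq R (u * v) (u' * v')
  | PresInv u u' : pres_eq R u u' -> pres_eq R u^-1 u'^-1
  | PresMulA u v w : pres_eq R (u * (v * w)) (u * v * w)
  | PresMul1 u : pres_eq R (1 * u) u
  | PresMulV u : pres_eq R (u^-1 * u) 1.

Section PresentedGroup.
Variables (X : Type) (R : gterm X -> gterm X -> Prop).

Definition pres_eqb (u v : gterm X) : bool := `[< pres_eq R u v >].

Fact pres_eqb_refl : reflexive pres_eqb.
Proof. by move=> u; apply/asboolP; apply: PresRefl. Qed.

Fact pres_eqb_sym : symmetric pres_eqb.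
Proof. by move=> u v; apply/asboolP/asboolP; apply: PresSym. Qed.

Fact pres_eqb_trans : transitive pres_eqb.
Proof.
by move=> v u w /asboolP uv /asboolP vw; apply/asboolP; apply: PresTrans uv vw.
Qed.

Canonical pres_equiv :=
  EquivRel pres_eqb pres_eqb_refl pres_eqb_sym pres_eqb_trans.

Definition pres_group : Type := {eq_quot pres_equiv}%qT.

HB.instance Definition _ := Choice.on pres_group.

Definition pres_class (u : gterm X) : pres_group :=
  (\pi_({eq_quot pres_equiv}) u)%qT.

Definition pres_repr (x : pres_group) : gterm X :=
  repr (x : {eq_quot pres_equiv}%qT).

Fact pres_classP u v : pres_class u = pres_class v <-> pres_eq R u v.
Proof.
split=> [/eqP|uv].
  by rewrite /pres_class eqmodE /= => /asboolP.
by apply/eqP; rewrite /pres_class eqmodE /=; apply/asboolP.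
Qed.

Fact pres_reprK x : pres_class (pres_repr x) = x.
Proof. exact: reprK. Qed.

Definition pres_one : pres_group := pres_class 1.
Definition pres_mul (x y : pres_group) : pres_group :=
  pres_class (pres_repr x * pres_repr y).
Definition pres_inv (x : pres_group) : pres_group :=
  pres_class (pres_repr x)^-1.

Fact pres_mulE u v :
  pres_mul (pres_class u) (pres_class v) = pres_class (u * v).
Proof.
by apply/pres_classP; apply: PresMul; apply/pres_classP; rewrite pres_reprK.
Qed.

Fact pres_invE u : pres_inv (pres_class u) = pres_class u^-1.
Proof. by apply/pres_classP/PresInv/pres_classP; rewrite pres_reprK. Qed.

Fact pres_mulA : associative pres_mul.
Proof.
move=> x y z; rewrite -(pres_reprK x) -(pres_reprK y) -(pres_reprK z) !pres_mulE.
exact/pres_classP/PresMulA.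
Qed.

Fact pres_mul1 : left_id pres_one pres_mul.
Proof.
by move=> x; rewrite -(pres_reprK x) pres_mulE; apply/pres_classP/PresMul1.
Qed.

Fact pres_mulV : left_inverse pres_one pres_inv pres_mul.
Proof.
move=> x; rewrite -(pres_reprK x) pres_invE pres_mulE.
exact/pres_classP/PresMulV.
Qed.

Fact pres_mulrV : right_inverse pres_one pres_inv pres_mul.
Proof.
move=> x; rewrite -[LHS]pres_mul1 -[in LHS](pres_mulV (pres_inv x)) -pres_mulA.
by rewrite [pres_mul (pres_inv x) _]pres_mulA pres_mulV pres_mul1 pres_mulV.
Qed.

Fact pres_mulr1 : right_id pres_one pres_mul.
Proof. by move=> x; rewrite -(pres_mulV x) pres_mulA pres_mulrV pres_mul1. Qed.

HB.instance Definition _ := isGroup.Build pres_group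
  pres_mulA pres_mul1 pres_mulr1 pres_mulV pres_mulrV.

Definition pres_gen (x : X) : pres_group := pres_class (Gen x).

End PresentedGroup.

(** * The mixed braid groups of a surface of genus g with one boundary curve *)

(* Generators of B_{n,k}(Sigma), the k-strand braid group of Sigma minus n
   points. Indices start at 0 instead of 1: [Sigma i] is sigma_{i+1}, so that
   sigma_1 is the [Sigma i] with [i = 0 :> nat]. *)
Inductive sgen (n k g : nat) : Type :=
  | Sigma of 'I_k.-1
  | Zeta of 'I_n
  | Mu of 'I_g
  | Lambda of 'I_g.
Arguments Sigma {n k g} _.
Arguments Zeta {n k g} _.
Arguments Mu {n k g} _.
Arguments Lambda {n k g} _.

Section SurfaceRelations.
Variables n k g : nat.
Implicit Types x y : sgen n k g.

Definition is_sigma x : bool := if x is Sigma _ then true else false.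

(* The pairs (x, y) for which [x, sigma_1^-1 y sigma_1] = 1 is imposed. *)
Definition precedes x y : bool :=
  match x, y with
  | Mu r, Mu s | Mu r, Lambda s | Lambda r, Mu s | Lambda r, Lambda s => r < s
  | Mu _, Zeta _ | Lambda _, Zeta _ => true
  | Zeta t, Zeta u => t < u
  | _, _ => false
  end.

(* The relations are read on terms over any type Y into which the generators are
   sent by [e], so that they can be used for both factors of B_{n;k}(Sigma). *)
Variables (Y : Type) (e : sgen n k g -> gterm Y).

Inductive surface_rel : gterm Y -> gterm Y -> Prop :=
  | SR_far (i j : 'I_k.-1) : i.+2 <= j \/ j.+2 <= i ->
      surface_rel (Comm (e (Sigma i)) (e (Sigma j))) 1
  | SR_braid (i j : 'I_k.-1) :
      j = i.+1 :> nat \/ i = j.+1 :> nat ->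
      surface_rel (e (Sigma i) * e (Sigma j) * e (Sigma i))
                  (e (Sigma j) * e (Sigma i) * e (Sigma j))
  | SR_sigma x (i : 'I_k.-1) : ~~ is_sigma x -> 0 < i ->
      surface_rel (Comm (e x) (e (Sigma i))) 1
  | SR_self x (s1 : 'I_k.-1) : ~~ is_sigma x -> s1 = 0 :> nat ->
      surface_rel (Comm (e x) (e (Sigma s1) * e x * e (Sigma s1))) 1
  | SR_pair x y (s1 : 'I_k.-1) : precedes x y -> s1 = 0 :> nat ->
      surface_rel (Comm (e x) ((e (Sigma s1))^-1 * e y * e (Sigma s1))) 1
  | SR_genus (r : 'I_g) (s1 : 'I_k.-1) : s1 = 0 :> nat ->
      surface_rel
        (e (Sigma s1) * e (Lambda r) * e (Sigma s1) * e (Mu r) * e (Sigma s1))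
        (e (Mu r) * e (Sigma s1) * e (Lambda r)).

End SurfaceRelations.

(* X_1 is [sgen 0 n g], the generators of B_{0,n}(Sigma), and X_2 is
   [sgen n k g], those of B_{n,k}(Sigma). *)
Definition mgen (n k g : nat) : Type := (sgen 0 n g + sgen n k g)%type.

Section MixedBraidGroup.
Variables n k g : nat.

Definition bar_term (x : sgen 0 n g) : gterm (mgen n k g) := Gen (inl x).
Definition std_term (y : sgen n k g) : gterm (mgen n k g) := Gen (inr y).

(* [star z1 x y] is \bar x_*(y), where z1 is the index of zeta_1. In the first
   clause j = i (resp. j = i+1) says that y is zeta_i (resp. zeta_{i+1});
   [ordS] and [ord_pred] do not wrap around there since i < n-1. *)
Definition star (z1 : 'I_n) (x : sgen 0 n g) (y : sgen n k g) :
    gterm (mgen n k g) :=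
  let E := std_term in
  let z := E (Zeta z1) in
  let w := E y in
  match x, y with
  | Sigma i, Zeta j =>
      if j == i :> nat then w * E (Zeta (ordS j)) * w^-1
      else if j == i.+1 :> nat then E (Zeta (ord_pred j))
      else w
  | Mu r, Zeta j =>
      if j == z1 then E (Mu r) * z * (E (Mu r))^-1 else w
  | Mu r, Mu s =>
      let m := E (Mu r) in
      if s == r then m * z * m * z^-1 * m^-1
      else if r < s then Comm m z * w * (Comm m z)^-1 else w
  | Mu r, Lambda s =>
      let m := E (Mu r) in
      if s == r then w * m * z^-1 * m^-1
      else if r < s then Comm m z * w * (Comm m z)^-1 else w
  | Lambda r, Zeta j =>
      if j == z1 then E (Lambda r) * z * (E (Lambda r))^-1 else w
  | Lambda r, Mu s =>
      let l := E (Lambda r) in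
      if s == r then l * z * l^-1 * w * z * l * z^-1 * l^-1
      else if r < s then Comm l z * w * (Comm l z)^-1 else w
  | Lambda r, Lambda s =>
      let l := E (Lambda r) in
      if s == r then l * z * l * z^-1 * l^-1
      else if r < s then Comm l z * w * (Comm l z)^-1 else w
  | _, _ => w
  end%gt.

Inductive mixed_rel : gterm (mgen n k g) -> gterm (mgen n k g) -> Prop :=
  | MR_std u v : surface_rel std_term u v -> mixed_rel u v
  | MR_bar u v : surface_rel bar_term u v -> mixed_rel u v
  | MR_act (z1 : 'I_n) x y : z1 = 0 :> nat ->
      mixed_rel ((bar_term x)^-1 * std_term y * bar_term x) (star z1 x y).

(* B_{n;k}(Sigma) for n > 0. When n = 1 there is no \bar sigma, so [MR_bar] gives
   no relation, in accordance with B_{0,1}(Sigma) = pi_1(Sigma) being free of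
   rank 2g. *)
Definition mixed_braid_group : groupType := pres_group mixed_rel.

Definition bsigma (m : 'I_n.-1) : mixed_braid_group :=
  pres_gen mixed_rel (inl (Sigma m)).
Definition sigma (i : 'I_k.-1) : mixed_braid_group :=
  pres_gen mixed_rel (inr (Sigma i)).
Definition zeta (j : 'I_n) : mixed_braid_group :=
  pres_gen mixed_rel (inr (Zeta j)).

End MixedBraidGroup.

(** * The group H_Sigma *)

Inductive hgen (g : nat) : Type :=
  | Hq | Ht
  | Hmbar of 'I_g | Hlbar of 'I_g
  | Hm of 'I_g | Hl of 'I_g.
Arguments Hq {g}.
Arguments Ht {g}.

(* The unordered pairs of generators that are not required to commute. *)
Definition hexcept g (x y : hgen g) : bool :=
  match x, y with
  | Hm r, Hl s | Hl r, Hm s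
  | Hmbar r, Hl s | Hl r, Hmbar s
  | Hm r, Hlbar s | Hlbar r, Hm s => r == s
  | _, _ => false
  end.

Inductive hrel g : gterm (hgen g) -> gterm (hgen g) -> Prop :=
  | HR_comm x y : ~~ hexcept x y -> hrel (Comm (Gen x) (Gen y)) 1
  | HR_ml r : hrel (Comm (Gen (Hm r)) (Gen (Hl r))) (Gen Ht * Gen Ht)
  | HR_mbl r : hrel (Comm (Gen (Hmbar r)) (Gen (Hl r))) (Gen Hq)
  | HR_mlb r : hrel (Comm (Gen (Hm r)) (Gen (Hlbar r))) (Gen Hq).

Definition HSigma (g : nat) : groupType := pres_group (@hrel g).

(** * Rank 2 free abelian subgroups and isomorphisms *)

Definition zpow (G : groupType) (x : G) (a : int) : G :=
  match a with Posz m => (x ^+ m)%g | Negz m => (x ^- m.+1)%g end.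

(* The subgroup generated by q and t is free abelian with basis (q, t). *)
Definition free_abelian_pair (G : groupType) (q t : G) : Prop :=
  commute q t /\
  forall a b : int, (zpow q a * zpow t b = 1)%g -> a = 0%R /\ b = 0%R.

Definition isomorphic (G K : groupType) : Prop :=
  exists f : {multiplicative G -> K}, bijective f.

(* Main.v *)
Require Import Defs.
From mathcomp Require Import all_boot.
From HB Require Import structures.
From mathcomp Require Import all_algebra boolp.

Set Implicit Arguments.
Unset Strict Implicit.
Unset Printing Implicit Defensive.

(** Write F for the composite of psi with the generators, and M_r, L_r, bM_r,
    bL_r for the images of mu_r, lambda_r and their barred versions.

    The relations force the image to be nilpotent of class 2. As k >= 3 there
    is a sigma_2, and it commutes with every mu_r, lambda_r and zeta_j; the
    barred generators act trivially on the sigma_i; hence t is central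
    ([t_central]). Once t is central the relations containing conjugation by
    sigma_1 become honest commutations, so q commutes with M_r and L_r, and the
    action of the barred generators on zeta_1 then makes q central too
    ([q_central]). With q and t central, each remaining relation of the mixed
    braid group collapses to a defining relation of H_Sigma: the genus relation
    becomes [M_r, L_r] = t^2, its barred copy becomes [bM_r, bL_r] = 1 because
    the barred sigma_1 is sent to 1, and the action of the barred generators
    gives [bM_r, L_r] = [M_r, bL_r] = q. This yields a surjective homomorphism
    phi : H_Sigma -> H ([model_rel], [model_surjective]).

    Injectivity of phi needs no normal form in H, only the independence of q and
    t. Let u be a word with phi(u) = 1. The commutator of phi(u) with L_r is
    trivial, but it is also q^a t^(2b), where a and b are the exponent sums in u
    of the generators bm_r and m_r; so a = b = 0. Commuting with M_r gives the
    same for the generators bl_r and l_r ([weight_mu_eq0],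
    [weight_lambda_eq0]). Modulo the central subgroup generated by q and t the
    group H_Sigma is abelian, so a word whose other exponent sums all vanish
    lies in that subgroup ([geval_in_center]). Hence u = q^a t^b, and phi(u) = 1
    forces a = b = 0 once more ([model_injective]). *)

Local Open Scope group_scope.

(** * Homomorphisms out of presented groups *)

Fixpoint geval (X : Type) (G : groupType) (f : X -> G) (u : gterm X) : G :=
  match u with
  | Gen x => f x
  | One => 1
  | Mul u v => geval f u * geval f v
  | Inv u => (geval f u)^-1
  end.

Lemma geval_commute (X : Type) (G : groupType) (f : X -> G) (z : G) u :
  (forall x, commute z (f x)) -> commute z (geval f u).
Proof.
move=> zf; elim: u => //= [|u zu v zv | u zu].
- exact: commute1.
- exact: commuteM.
- exact: commuteV.
Qed.

Lemma geval_morph (X : Type) (R : gterm X -> gterm X -> Prop) (G : groupType)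
    (phi : {multiplicative pres_group R -> G}) u :
  phi (pres_class R u) = geval (fun x => phi (pres_gen R x)) u.
Proof.
have phi1 : phi 1 = 1 by apply: (@mulgI _ (phi 1)); rewrite -gmulfM !mulg1.
elim: u => //= [u <- v <-|u <-].
- by rewrite -gmulfM; congr (phi _); apply/esym/pres_mulE.
- apply/esym/mulg1_eq; rewrite -gmulfM -phi1; congr (phi _).
  by rewrite -pres_invE [_ * _]pres_mulrV.
Qed.

Lemma geval_pres_gen (X : Type) (R : gterm X -> gterm X -> Prop) u :
  geval (pres_gen R) u = pres_class R u.
Proof. exact/esym/(@geval_morph _ R (pres_group R) idfun). Qed.

Section Lift.
Variables (X : Type) (R : gterm X -> gterm X -> Prop).
Variables (G : groupType) (f : X -> G).
Hypothesis fR : forall u v, R u v -> geval f u = geval f v.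

Lemma geval_pres_eq u v : pres_eq R u v -> geval f u = geval f v.
Proof.
elim=> {u v} //=.
- by move=> u v w _ -> _ ->.
- by move=> u u' v v' _ -> _ ->.
- by move=> u u' _ ->.
- by move=> u v w; rewrite mulgA.
- by move=> u; rewrite mul1g.
- by move=> u; rewrite mulVg.
Qed.

(** The universal property of a presented group. *)
Lemma pres_lift : exists phi : UMagmaMorphism.type (pres_group R) G,
  forall u, phi (pres_class R u) = geval f u.
Proof.
pose h (x : pres_group R) := geval f (pres_repr x).
have hE u : h (pres_class R u) = geval f u.
  by apply/geval_pres_eq/pres_classP; rewrite pres_reprK.
have h_morph : monoid_morphism h.
  split=> [|x y]; first exact: (hE 1%gt).
  by rewrite -{1}(pres_reprK x) -{1}(pres_reprK y) [_ * _]pres_mulE hE.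
pose h_mixin := isUMagmaMorphism.Build _ _ h h_morph.
pose phi : UMagmaMorphism.type (pres_group R) G := HB.pack h h_mixin.
by exists phi.
Qed.

End Lift.

Lemma geval_rel (X : Type) (R : gterm X -> gterm X -> Prop) (G : groupType)
    (phi : {multiplicative pres_group R -> G}) u v :
  R u v ->
  geval (fun x => phi (pres_gen R x)) u = geval (fun x => phi (pres_gen R x)) v.
Proof.
by move=> Ruv; rewrite -!geval_morph; congr (phi _); apply/pres_classP/PresRel.
Qed.

Lemma isomorphic_of_bijective (G K : groupType)
    (f : UMagmaMorphism.type G K) :
  injective f -> (forall y, exists x, f x = y) -> isomorphic K G.
Proof.
move=> finj fsurj_ex; have fsurj y := cid (fsurj_ex y).
pose h y := sval (fsurj y).
have hK : cancel h f by move=> y; rewrite /h; case: (fsurj y).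
have fK : cancel f h by move=> x; apply: finj; rewrite hK.
have hM : {morph h : x y / x * y} by apply: can2_gmulfM fK hK.
pose hm := isMultiplicative.Build K G h hM.
pose hmul : {multiplicative K -> G} := HB.pack h hm.
by exists hmul; exists f.
Qed.

(** * Integer powers and exponent sums *)

Section IntegerPowers.
Variable G : groupType.
Implicit Types (x y : G) (a b : int).

Lemma zpow0 x : zpow x 0%R = 1. Proof. by []. Qed.

Lemma zpow1z a : zpow (1 : G) a = 1.
Proof. by case: a => m /=; rewrite expg1n ?invg1. Qed.

Lemma zpowSz x a : zpow x (1 + a)%R = x * zpow x a.
Proof.
case: a => [m|[|m]] /=; first exact: expgS.
  by rewrite mulgV.
by rewrite [x ^+ m.+2]expgSr invgM mulVKg subn1.
Qed.

Lemma zpowD x a b : zpow x (a + b)%R = zpow x a * zpow x b.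
Proof.
have zpowDn (m : nat) c : zpow x (Posz m + c)%R = x ^+ m * zpow x c.
  elim: m => [|m IH]; first by rewrite GRing.add0r mul1g.
  by rewrite -[m.+1]add1n PoszD -GRing.addrA zpowSz IH mulgA -expgS.
case: a => m; first exact: zpowDn.
rewrite NegzE /=; apply: (@mulgI _ (x ^+ m.+1)).
by rewrite mulVKg -zpowDn GRing.addrA GRing.subrr GRing.add0r.
Qed.

Lemma zpowN x a : zpow x (- a)%R = (zpow x a)^-1.
Proof. by apply/esym/mulg1_eq; rewrite -zpowD GRing.subrr. Qed.

Lemma commute_zpow x y a : commute x y -> commute x (zpow y a).
Proof. by case: a => m xy /=; [|apply: commuteV]; apply: commuteX. Qed.

End IntegerPowers.

Lemma gmulf_zpow (G K : groupType) (f : UMagmaMorphism.type G K) x a :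
  f (zpow x a) = zpow (f x) a.
Proof. by case: a => m /=; rewrite ?gmulfXVn ?gmulfXn. Qed.

Section Weight.
Variable X : Type.
Implicit Types (w : X -> int) (u : gterm X).

(** With w the indicator of a generator x this is the exponent sum of x in u;
    other integer weights allow a commutator exponent to be read off directly
    from a word. *)
Fixpoint weight w u : int :=
  match u with
  | Gen x => w x
  | One => 0%R
  | Mul u v => (weight w u + weight w v)%R
  | Inv u => (- weight w u)%R
  end.

Lemma weightM w (a : int) u :
  weight (fun x => a * w x)%R u = (a * weight w u)%R.
Proof.
elim: u => //= [|u -> v ->|u ->].
- by rewrite GRing.mulr0.
- by rewrite GRing.mulrDr.
- by rewrite GRing.mulrN.
Qed.

End Weight.

(** * Words modulo a central subgroup *)

Section AbelianNormalForm.
Variables (X : eqType) (A : groupType) (f : X -> A).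
Hypothesis fC : forall x y, commute (f x) (f y).

Fixpoint letters (u : gterm X) : seq X :=
  match u with
  | Gen x => [:: x]
  | One => [::]
  | Mul u v => letters u ++ letters v
  | Inv u => letters u
  end.

(** In an abelian group a word is determined by its exponent sums. The product
    runs over a given list s since X may be infinite; any duplicate-free list
    containing the letters of u gives the same value, which allows the induction
    on u to keep s fixed. *)
Lemma abelian_normal_form (s : seq X) u : uniq s -> {subset letters u <= s} ->
  geval f u =
    \big[*%g/1]_(x <- s) zpow (f x) (weight (fun y => Posz (y == x)) u).
Proof.
have prodD (d e : X -> int) :
    \big[*%g/1]_(x <- s) zpow (f x) (d x + e x)%R =
    \big[*%g/1]_(x <- s) zpow (f x) (d x) *
    \big[*%g/1]_(x <- s) zpow (f x) (e x).
  rewrite -prodgM_commute => [|x y _ _].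
    by apply: eq_bigr => x _; rewrite zpowD.
  by apply/commute_zpow/commute_sym/commute_zpow.
move=> s_uniq; elim: u => /= [y|_|u IHu v IHv us|u IHu us].
- move=> /(_ y (mem_head _ _)) ys; case/splitPr: ys s_uniq => s1 s2.
  rewrite uniq_catC cons_uniq mem_cat negb_or => /andP[/andP[ys2 ys1] _] {prodD}.
  have off r : y \notin r -> \big[*%g/1]_(x <- r) zpow (f x) (Posz (y == x)) = 1.
    move=> yr; rewrite big_seq big1 // => x xr.
    by case: eqP => // yx; rewrite yx xr in yr.
  by rewrite big_cat big_cons /= !off // eqxx mulg1 mul1g.
- by rewrite big1.
- rewrite IHu ?IHv ?prodD // => x xu; apply: us; rewrite mem_cat xu ?orbT //.
- rewrite IHu //; apply: mulg1_eq; rewrite -prodD big1 // => x _.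
  by rewrite GRing.subrr.
Qed.

Lemma geval_eq1 u :
  (forall x, f x = 1 \/ weight (fun y => Posz (y == x)) u = 0%R) ->
  geval f u = 1.
Proof.
move=> trivial_or; rewrite (@abelian_normal_form (undup (letters u))).
- by rewrite big1 // => x _; case: (trivial_or x) => ->; rewrite ?zpow1z.
- exact: undup_uniq.
- by move=> x; rewrite mem_undup.
Qed.

End AbelianNormalForm.

(** The quotient of G by the central subgroup Z is needed only on words in the
    f x, so it is obtained as the group presented by all the relations u = v
    that hold modulo Z; [pres_eqmod] says that no further relation arises. *)
Section ModuloCenter.
Variables (X : eqType) (G : groupType) (f : X -> G) (Z : G -> Prop).
Hypotheses (Z1 : Z 1) (ZM : forall x y, Z x -> Z y -> Z (x * y)).
Hypotheses (ZV : forall x, Z x -> Z x^-1).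
Hypothesis Zcentral : forall x y, Z x -> commute x y.
Hypothesis fC : forall x y, Z (f x * f y / (f y * f x)).

Let eqmod (u v : gterm X) : Prop := Z (geval f u / geval f v).

Let pres_eqmod u v : pres_eq eqmod u v -> eqmod u v.
Proof.
elim=> {u v} //=; rewrite /eqmod /=.
- by move=> u; rewrite mulgV.
- by move=> u v _ /ZV; rewrite invgF.
- by move=> u v w _ uv _ vw; rewrite -(mulgVK (geval f v) (geval f u)) -mulgA;
    apply: ZM.
- move=> u u' v v' _ uu' _ vv'.
  rewrite invgM -mulgA [geval f v * _]mulgA (Zcentral _ vv') mulgA.
  exact: ZM.
- move=> u u' _ /ZV; rewrite invgF invgK => u'u.
  by rewrite -[geval f u'](mulgVK (geval f u)) (Zcentral _ u'u) mulKg.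
- by move=> u v w; rewrite mulgA mulgV.
- by move=> u; rewrite mul1g mulgV.
- by move=> u; rewrite mulVg mulgV.
Qed.

(** In the quotient by Z the f x commute and those lying in Z become trivial, so
    a word whose other exponent sums vanish has trivial image there. *)
Lemma geval_in_center u :
  (forall x, Z (f x) \/ weight (fun y => Posz (y == x)) u = 0%R) ->
  Z (geval f u).
Proof.
move=> central_or.
have u1 : pres_class eqmod u = 1.
  rewrite -geval_pres_gen; apply: geval_eq1 => [x y|x].
    rewrite /commute [LHS]pres_mulE [RHS]pres_mulE.
    exact/pres_classP/PresRel/fC.
  case: (central_or x) => [Zx|]; [left|by right].
  by apply/pres_classP/PresRel; rewrite /eqmod /= invg1 mulg1.
by have /pres_classP/pres_eqmod := u1; rewrite /eqmod /= invg1 mulg1.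
Qed.

End ModuloCenter.

(** Commuting with y is multiplicative as long as the commutators are central;
    this is the bilinearity of the commutator in a group of class 2. *)
Lemma geval_commutator (X : Type) (G : groupType) (f : X -> G) (q t y : G)
    (wq wt : X -> int) u :
  (forall z, commute q z) -> (forall z, commute t z) ->
  (forall x, f x * y = zpow q (wq x) * zpow t (wt x) * (y * f x)) ->
  geval f u * y =
    zpow q (weight wq u) * zpow t (weight wt u) * (y * geval f u).
Proof.
move=> qC tC fy; pose c a b := zpow q a * zpow t b.
have cC a b z : commute z (c a b).
  by apply: commuteM; apply: commute_zpow; apply: commute_sym.
have cD a b a' b' : c (a + a')%R (b + b')%R = c a b * c a' b'.
  rewrite /c !zpowD -!mulgA; congr (_ * _).
  by rewrite !mulgA; congr (_ * _); apply/commute_zpow/commute_sym/commute_zpow.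
elim: u => //= [|u IHu v IHv|u IHu].
- by rewrite !mul1g mulg1.
- rewrite -!/(c _ _) in IHu IHv *.
  rewrite cD -(mulgA (geval f u)) IHv mulgA (cC _ _ (geval f u)) -mulgA.
  by rewrite (mulgA (geval f u) y) IHu (cC _ _ (c (weight wq u) _)) !mulgA.
- rewrite -!/(c _ _) in IHu *.
  have -> : c (- weight wq u)%R (- weight wt u)%R =
      (c (weight wq u) (weight wt u))^-1.
    by apply/esym/mulg1_eq; rewrite -cD !GRing.subrr /c mulg1.
  apply: (@mulgI _ (geval f u)); rewrite mulVKg !mulgA.
  by rewrite (commuteV (cC _ _ _)) -[_ * _ * y]mulgA IHu mulKg mulgK.
Qed.

(** * Surface braid relations when the sigma_i have a common central image *)

(** Both factors of the mixed braid group are covered: the unbarred generators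
    with the image t of sigma_i, and the barred ones with image 1. *)
Section SurfaceImages.
Variables (n k g : nat) (Y : Type) (e : sgen n k g -> gterm Y).
Variables (G : groupType) (f : Y -> G) (t : G).
Hypotheses (k_gt1 : 1 < k).
Hypothesis f_rel : forall u v, surface_rel e u v -> geval f u = geval f v.
Hypothesis f_sigma : forall i, geval f (e (Sigma i)) = t.
Hypothesis tC : forall x, commute t x.

Let s1 : 'I_k.-1 := Ordinal (etrans (ltn_predRL 0 k) k_gt1).

Lemma surface_pair_commute x y :
  precedes x y -> commute (geval f (e x)) (geval f (e y)).
Proof.
move=> /(SR_pair e)/(_ (erefl : s1 = 0 :> nat))/f_rel /=; rewrite f_sigma.
rewrite -[t^-1 * _ * t]mulgA -tC mulKg.
by move/divg1_eq/(canRL (mulgVK _)).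
Qed.

Lemma surface_genus_commutator r :
  geval f (e (Mu r)) * geval f (e (Lambda r)) =
    t * t * (geval f (e (Lambda r)) * geval f (e (Mu r))).
Proof.
have /f_rel /= := SR_genus e r (erefl : s1 = 0 :> nat); rewrite f_sigma.
(* The relation reads t l t m t = m t l, that is t^3 l m = t m l. *)
set l := geval f _; set m := geval f _ => genus.
apply: (@mulgI _ t); rewrite mulgA (tC m) -genus.
by rewrite -[t * l * t]mulgA -(tC l) -(tC (t * (t * l) * m)) !mulgA.
Qed.

End SurfaceImages.

(** * The central subgroup of H_Sigma generated by q and t *)

HB.instance Definition _ (g : nat) := gen_eqMixin (hgen g).

Section CentralSubgroup.
Variable g : nat.

Local Notation hel := (pres_gen (@hrel g)).

Definition in_qt (x : HSigma g) : Prop :=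
  exists a b : int, x = zpow (hel Hq) a * zpow (hel Ht) b.

Lemma hel_rel u v : hrel u v -> geval hel u = geval hel v.
Proof. by move=> uv; rewrite !geval_pres_gen; apply/pres_classP/PresRel. Qed.

Lemma hel_commute x y : ~~ hexcept x y -> commute (hel x) (hel y).
Proof.
by move/HR_comm/hel_rel => /= /divg1_eq/(canRL (mulgVK _)).
Qed.

Lemma hel_central x (z : HSigma g) :
  (forall y, ~~ hexcept x y) -> commute (hel x) z.
Proof.
move=> xC; rewrite -(pres_reprK z) -geval_pres_gen; apply: geval_commute => y.
exact/hel_commute/xC.
Qed.

Lemma in_qt_central x y : in_qt x -> commute x y.
Proof.
move=> [a [b ->]]; apply/commute_sym/commuteM; apply/commute_zpow/commute_sym.
  exact: hel_central.
exact: hel_central.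
Qed.

Lemma in_qt1 : in_qt 1.
Proof. by exists 0%R, 0%R; rewrite mul1g. Qed.

Lemma in_qtM x y : in_qt x -> in_qt y -> in_qt (x * y).
Proof.
move=> [a [b ->]] [a' [b' ->]]; exists (a + a')%R, (b + b')%R.
rewrite !zpowD -!mulgA; congr (_ * _); rewrite !mulgA; congr (_ * _).
by apply/commute_zpow/commute_sym/commute_zpow/hel_central.
Qed.

Lemma in_qtV x : in_qt x -> in_qt x^-1.
Proof.
move=> [a [b ->]]; exists (- a)%R, (- b)%R; rewrite !zpowN invgM.
apply/commuteV/commute_sym/commuteV/commute_zpow/commute_sym/commute_zpow.
exact: hel_central.
Qed.

Lemma in_qt_commutator x y : in_qt (hel x * hel y / (hel y * hel x)).
Proof.
have in_q : in_qt (hel Hq) by exists 1%R, 0%R; rewrite mulg1.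
have in_tt : in_qt (hel Ht * hel Ht) by exists 0%R, (Posz 2); rewrite mul1g.
have [xy|/hel_commute ->] := boolP (hexcept x y); last first.
  by rewrite mulgV; apply: in_qt1.
have ml r := hel_rel (HR_ml r); have mbl r := hel_rel (HR_mbl r).
have mlb r := hel_rel (HR_mlb r).
have comm_in x' y' z : in_qt z ->
    hel x' * hel y' * (hel x')^-1 * (hel y')^-1 = z ->
    in_qt (hel x' * hel y' / (hel y' * hel x')) /\
    in_qt (hel y' * hel x' / (hel x' * hel y')).
  move=> + E; rewrite -{}E -mulgA -invgM => Zz; split=> //.
  by rewrite -invgF; apply: in_qtV.
case: x y xy => [||r|r|r|r] [||s|s|s|s] //= /eqP <-.
- by have [] := comm_in _ _ _ in_q (mbl r).
- by have [] := comm_in _ _ _ in_q (mlb r).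
- by have [] := comm_in _ _ _ in_q (mlb r).
- by have [] := comm_in _ _ _ in_tt (ml r).
- by have [] := comm_in _ _ _ in_q (mbl r).
- by have [] := comm_in _ _ _ in_tt (ml r).
Qed.

End CentralSubgroup.

(** * The homomorphism from H_Sigma to H *)

(** The homomorphism psi is given by its values F on the generators. *)
Section ImageOfMixedBraidGroup.
Variables (g n k : nat) (hn : 0 < n) (hn1 : n = 1%N -> g = 0).
Hypothesis hk : 2 < k.
Variables (H : groupType) (q t : H).
Variable F : mgen n k g -> H.
Hypothesis F_rel : forall u v, mixed_rel u v -> geval F u = geval F v.
Hypothesis F_surj : forall h, exists u, geval F u = h.
Hypothesis F_sigma : forall i, F (inr (Sigma i)) = t.
Hypothesis F_zeta : forall j, F (inr (Zeta j)) = q.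
Hypothesis F_bsigma : forall m, F (inl (Sigma m)) = 1.

Let z1 : 'I_n := Ordinal hn.

Lemma central_of_gens z : (forall y, commute z (F y)) -> forall h, commute z h.
Proof. by move=> zF h; have [u <-] := F_surj h; apply: geval_commute. Qed.

Lemma star_eval x y :
  F (inr y) * F (inl x) = F (inl x) * geval F (star z1 x y).
Proof.
have /F_rel /= xy := MR_act x y (erefl : z1 = 0 :> nat).
by rewrite -xy -mulgA mulVKg.
Qed.

(** This is where k >= 3 enters: only the sigma_i with i > 1 are required to
    commute with mu_r, lambda_r and zeta_j, and all sigma_i have the image t. *)
Lemma t_central : forall h, commute t h.
Proof.
apply: central_of_gens => -[x|y].
  have s1 : 'I_k.-1 by exists 0; rewrite ltn_predRL ltnW.
  have := star_eval x (Sigma s1).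
  have -> : star z1 x (Sigma s1) = Gen (inr (Sigma s1)) by case: x.
  by rewrite /= F_sigma.
have [|y_not_sigma] := boolP (is_sigma y).
  by case: y => // i _; rewrite F_sigma.
have s2_lt : 1 < k.-1 by rewrite ltn_predRL.
have := SR_sigma (@std_term n k g) (i := Ordinal s2_lt) y_not_sigma isT.
move=> /MR_std/F_rel /=; rewrite F_sigma.
by move/divg1_eq/(canRL (mulgVK _))/commute_sym.
Qed.

Lemma std_pair x y : precedes x y -> commute (F (inr x)) (F (inr y)).
Proof.
move=> xy.
apply: (@surface_pair_commute _ _ _ _ (@std_term n k g) _ F t) => //.
- exact: ltnW.
- by move=> u v uv; apply/F_rel/MR_std.
- exact: t_central.
Qed.

(** The pairs with zeta give that q commutes with M_r and L_r. The barred mu_r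
    conjugates zeta_1 into mu_r zeta_1 mu_r^-1, whose image is again q, so it
    commutes with q as well; similarly for the barred lambda_r. *)
Lemma q_central : forall h, commute q h.
Proof.
have q_std y : commute q (F (inr y)).
  case: y => [i|j|r|r].
  - by rewrite F_sigma; apply/commute_sym/t_central.
  - by rewrite F_zeta.
  - by rewrite -(F_zeta z1); apply/commute_sym/std_pair.
  - by rewrite -(F_zeta z1); apply/commute_sym/std_pair.
apply: central_of_gens => -[[i|[]//|r|r]|y] //.
- by rewrite F_bsigma; apply: commute1.
- have := star_eval (Mu r) (Zeta z1).
  by rewrite /= ?eqxx /= F_zeta -(q_std (Mu r)) mulgK.
- have := star_eval (Lambda r) (Zeta z1).
  by rewrite /= ?eqxx /= F_zeta -(q_std (Lambda r)) mulgK.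
Qed.

(** For n = 1 there is no barred sigma, hence no relation among the barred
    generators; the commutations between them need n >= 2 unless g = 0. *)
Lemma bar_gt1 (r : 'I_g) : 1 < n.
Proof.
rewrite ltn_neqAle hn andbT eq_sym; apply/eqP => /hn1 g0.
by case: r; rewrite g0.
Qed.

Lemma bar_pair x y : precedes x y -> commute (F (inl x)) (F (inl y)).
Proof.
move=> xy; have n_gt1 : 1 < n.
  by case: x xy => [//|[]//|r|r] _; apply: bar_gt1 r.
apply: (@surface_pair_commute _ _ _ _ (@bar_term n k g) _ F 1) => //.
- by move=> u v uv; apply/F_rel/MR_bar.
- by move=> z; apply/commute_sym/commute1.
Qed.

Let qE x : x * q = q * x. Proof. exact/esym/q_central. Qed.
Let qVE x : x * q^-1 = q^-1 * x.
Proof. exact/commuteV/commute_sym/q_central. Qed.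
Let qJ x : x * q * x^-1 = q. Proof. by rewrite qE mulgK. Qed.

(** As q is central, the images of [mu_r, zeta_1] and [lambda_r, zeta_1] are
    trivial. Among the images of the mu_s and lambda_s, conjugation by bM_r can
    then change only L_r, and conjugation by bL_r only M_r. *)
Lemma bar_std_commute x y :
  match x, y with
  | Mu r, Mu s | Lambda r, Lambda s => true
  | Mu r, Lambda s | Lambda r, Mu s => r != s
  | _, _ => false
  end -> commute (F (inl x)) (F (inr y)).
Proof.
move=> xy; apply/esym; rewrite star_eval; congr (_ * _).
have cM (z w : H) : z * q * z^-1 * q^-1 * w * (z * q * z^-1 * q^-1)^-1 = w.
  by rewrite qJ mulgV mul1g invg1 mulg1.
have cV (z : H) : z * q * z * q^-1 * z^-1 = z.
  by rewrite qE qVE -(mulgA q) mulKg mulgK.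
case: x y xy => [//|[]//|r|r] [//|//|s|s] //=.
- move=> _; case: eqP => [->|_] /=; rewrite ?F_zeta ?cV //.
  by case: ifP => //= _; rewrite F_zeta cM.
- rewrite eq_sym => /negPf ->.
  by case: ifP => //= _; rewrite F_zeta cM.
- rewrite eq_sym => /negPf ->.
  by case: ifP => //= _; rewrite F_zeta cM.
- move=> _; case: eqP => [->|_] /=; rewrite ?F_zeta ?cV //.
  by case: ifP => //= _; rewrite F_zeta cM.
Qed.

(** The action gives bM_r^-1 L_r bM_r = L_r q^-1. *)
Lemma mubar_lambda r :
  F (inl (Mu r)) * F (inr (Lambda r)) =
    q * (F (inr (Lambda r)) * F (inl (Mu r))).
Proof.
rewrite star_eval /= eqxx /= F_zeta.
by rewrite qVE -!mulgA mulgV mulg1 (mulgA (F (inl _))) qVE -mulgA mulVKg.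
Qed.

(** The action gives bL_r^-1 M_r bL_r = q M_r. *)
Lemma mu_lambdabar r :
  F (inr (Mu r)) * F (inl (Lambda r)) =
    q * (F (inl (Lambda r)) * F (inr (Mu r))).
Proof.
rewrite star_eval /= eqxx /= F_zeta qJ qVE -!mulgA mulKg mulgV mulg1 qE.
by rewrite mulgA qE mulgA.
Qed.

Lemma mu_lambda r :
  F (inr (Mu r)) * F (inr (Lambda r)) =
    t * t * (F (inr (Lambda r)) * F (inr (Mu r))).
Proof.
apply: (@surface_genus_commutator _ _ _ _ (@std_term n k g) _ F t) => //.
- exact: ltnW.
- by move=> u v uv; apply/F_rel/MR_std.
- exact: t_central.
Qed.

Lemma bar_mu_lambda r : commute (F (inl (Mu r))) (F (inl (Lambda r))).
Proof.
rewrite /commute -[RHS]mul1g -[1 in RHS]mul1g.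
apply: (@surface_genus_commutator _ _ _ _ (@bar_term n k g) _ F 1) => //.
- exact: bar_gt1.
- by move=> u v uv; apply/F_rel/MR_bar.
- by move=> x; apply/commute_sym/commute1.
Qed.

Definition model_gen (x : hgen g) : H :=
  match x with
  | Hq => q
  | Ht => t
  | Hmbar r => F (inl (Mu r))
  | Hlbar r => F (inl (Lambda r))
  | Hm r => F (inr (Mu r))
  | Hl r => F (inr (Lambda r))
  end.

Lemma model_gen_commute x y :
  ~~ hexcept x y -> commute (model_gen x) (model_gen y).
Proof.
have std x' y' : precedes x' y' || precedes y' x' ->
    commute (F (inr x')) (F (inr y')).
  by case/orP=> /std_pair // /commute_sym.
have bar x' y' : precedes x' y' || precedes y' x' ->
    commute (F (inl x')) (F (inl y')).
  by case/orP=> /bar_pair // /commute_sym.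
have qCs z := commute_sym (q_central z); have tCs z := commute_sym (t_central z).
case: x y => [||r|r|r|r] [||s|s|s|s] //= rs;
  try by [apply: q_central | apply: t_central | apply: qCs | apply: tCs].
all: try by [apply: bar_std_commute => //=
  | apply/commute_sym/bar_std_commute => //=; rewrite eq_sym].
(* Both members of the pair are now barred, or both unbarred. *)
all: have [rs_eq|] := eqVneq r s; last first.
all: try by rewrite neq_ltn => r_s; apply: bar || apply: std.
all: subst s; first [exact: commute_refl | exact: bar_mu_lambda
  | exact/commute_sym/bar_mu_lambda | by rewrite eqxx in rs].
Qed.

Lemma model_rel u v : hrel u v -> geval model_gen u = geval model_gen v.
Proof.
case=> [x y|r|r|r] /=.
- by move/model_gen_commute => xy; rewrite xy mulgK mulgV.
- by rewrite mu_lambda mulgA !mulgK.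
- by rewrite mubar_lambda mulgA !mulgK.
- by rewrite mu_lambdabar mulgA !mulgK.
Qed.

Variable phi : UMagmaMorphism.type (HSigma g) H.
Hypothesis phiE : forall u, phi (pres_class (@hrel g) u) = geval model_gen u.

Lemma model_surjective h : exists x, phi x = h.
Proof.
have [u <-] := F_surj h.
suff [v <-] : exists v, geval model_gen v = geval F u.
  by exists (pres_class _ v); apply: phiE.
elim: u => /= [[[i|[]//|r|r]|[i|j|r|r]]||u [v <-] u' [v' <-]|u [v <-]].
- by exists 1%gt; rewrite F_bsigma.
- by exists (Gen (Hmbar r)).
- by exists (Gen (Hlbar r)).
- by exists (Gen Ht); rewrite F_sigma.
- by exists (Gen Hq); rewrite F_zeta.
- by exists (Gen (Hm r)).
- by exists (Gen (Hl r)).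
- by exists 1%gt.
- by exists (v * v')%gt.
- by exists (v^-1)%gt.
Qed.

Hypothesis qt_free : free_abelian_pair q t.

(** If a word has trivial image, so has its commutator with any y; independence
    of q and t then kills both exponents of that commutator. *)
Lemma weights_eq0 y (wq wt : hgen g -> int) u :
  (forall x, model_gen x * y =
    zpow q (wq x) * zpow t (wt x) * (y * model_gen x)) ->
  geval model_gen u = 1 -> weight wq u = 0%R /\ weight wt u = 0%R.
Proof.
move=> /(geval_commutator u q_central t_central) uy u1; apply: qt_free.2.
by move: uy; rewrite u1 mul1g mulg1 -[LHS]mul1g => /mulIg.
Qed.

(** The only generators with a nontrivial commutator with L_r are bM_r and M_r. *)
Lemma weight_mu_eq0 r u : geval model_gen u = 1 ->
  weight (fun x => Posz (x == Hmbar r)) u = 0%R /\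
  weight (fun x => Posz (x == Hm r)) u = 0%R.
Proof.
pose wt x := (Posz 2 * Posz (x == Hm r))%R.
move=> /(@weights_eq0 (F (inr (Lambda r))) (fun x => Posz (x == Hmbar r)) wt).
case=> [x|-> /eqP]; last first.
  by rewrite /wt weightM GRing.mulf_eq0 => /eqP->.
rewrite {}/wt; case: eqP => [->|not_mbar].
  by rewrite (_ : Hmbar r == Hm r = false) ?mulg1 ?mubar_lambda //; apply/eqP.
case: eqP => [->|not_m]; first by rewrite mul1g mu_lambda.
rewrite !mul1g; apply: (@model_gen_commute x (Hl r)).
by case: x not_mbar not_m => //= s nm nm'; apply/eqP => rs; subst s.
Qed.

(** The only generators with a nontrivial commutator with M_r are bL_r and L_r. *)
Lemma weight_lambda_eq0 r u : geval model_gen u = 1 ->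
  weight (fun x => Posz (x == Hlbar r)) u = 0%R /\
  weight (fun x => Posz (x == Hl r)) u = 0%R.
Proof.
pose wq x := (- 1 * Posz (x == Hlbar r))%R.
pose wt x := (- Posz 2 * Posz (x == Hl r))%R.
move=> /(@weights_eq0 (F (inr (Mu r))) wq wt).
case=> [x|/eqP + /eqP]; last first.
  by rewrite /wq /wt !weightM !GRing.mulf_eq0 /= => /eqP-> /eqP->.
rewrite {}/wq {}/wt; case: eqP => [->|not_lbar].
  rewrite (_ : Hlbar r == Hl r = false); last exact/eqP.
  by rewrite /= mulg1 mu_lambdabar mulKg.
case: eqP => [->|not_l]; first by rewrite /= mul1g mu_lambda mulKg.
rewrite !mul1g; apply: (@model_gen_commute x (Hm r)).
by case: x not_lbar not_l => //= s nm nm'; apply/eqP => rs; subst s.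
Qed.

Lemma model_injective : injective phi.
Proof.
apply: gmulf_inj => x; rewrite -(pres_reprK x); set u := pres_repr x.
rewrite phiE => u1.
have [||||||a [b uE]] := @geval_in_center _ _ (pres_gen (@hrel g)) (@in_qt g)
  _ _ _ _ _ u _.
- exact: in_qt1.
- exact: in_qtM.
- exact: in_qtV.
- by move=> y z; apply: in_qt_central.
- exact: in_qt_commutator.
- case=> [||r|r|r|r].
  + by left; exists 1%R, 0%R; rewrite mulg1.
  + by left; exists 0%R, 1%R; rewrite mul1g.
  + by right; have [] := weight_mu_eq0 r u1.
  + by right; have [] := weight_lambda_eq0 r u1.
  + by right; have [] := weight_mu_eq0 r u1.
  + by right; have [] := weight_lambda_eq0 r u1.
have [|a0 b0] := qt_free.2 a b.
  by rewrite -u1 -phiE -geval_pres_gen uE gmulfM !gmulf_zpow !phiE.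
by rewrite -geval_pres_gen uE a0 b0 mulg1.
Qed.

End ImageOfMixedBraidGroup.

Local Close Scope group_scope.

Theorem theorem4p3 (g n k : nat) (hn : 0 < n) (hn1 : n = 1 -> g = 0)
    (hk : 2 < k) (H : groupType) (q t : H) (hGD : free_abelian_pair q t)
    (psi : {multiplicative mixed_braid_group n k g -> H})
    (hsurj : forall h : H, exists b : mixed_braid_group n k g, psi b = h)
    (hsigma : forall i : 'I_k.-1, psi (sigma n g i) = t)
    (hzeta : forall j : 'I_n, psi (zeta k g j) = q)
    (hbsigma : forall m : 'I_n.-1, psi (bsigma k g m) = 1%g) :
  isomorphic H (HSigma g).
Proof.
pose F y := psi (pres_gen (@mixed_rel n k g) y).
have F_rel u v : mixed_rel u v -> geval F u = geval F v by apply: geval_rel.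
have F_surj h : exists u, geval F u = h.
  have [b <-] := hsurj h; exists (pres_repr b).
  by rewrite -geval_morph pres_reprK.
have [phi phiE] := pres_lift
  (model_rel hn hn1 hk F_rel F_surj hsigma hzeta hbsigma).
have phi_inj :=
  model_injective hn hn1 hk F_rel F_surj hsigma hzeta hbsigma phiE hGD.
have phi_surj := model_surjective F_surj hsigma hzeta hbsigma phiE.
exact (isomorphic_of_bijective phi_inj phi_surj).
Qed.
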